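(* Let $G$ be a graph of order $n$ and size $m$. If the Seidel matrix of $G$ is singular, then $$m+n_{odd}\equiv \frac{n-1}{4}\pmod 4,$$ where $n_{odd}$ is the number of vertices of $G$ of odd degree.
   Context: All graphs are simple, undirected, finite, with at least one vertex. The order of a graph is its number of vertices and its size is its number of edges. For a graph $G$ with vertices $v_1,\dots,v_n$ and adjacency matrix $A$, the Seidel matrix of $G$ is $S=J_n-I_n-2A$, where $J_n$ is the all-ones $n\times n$ matrix and $I_n$ the identity. If the Seidel matrix of a graph of order $n$ is singular, then $n\equiv 1\pmod 4$, so $\frac{n-1}{4}$ is an integer and the congruence is between integers. *)

(* Defs.v *)
From mathcomp Require Import all_boot all_order all_algebra.

Set Implicit Arguments.
Unset Strict Implicit.
Unset Printing Implicit Defensive.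

Import Order.TTheory GRing.Theory Num.Theory.
Local Open Scope ring_scope.

Record sgraph := SGraph {
  vertex :> finType;
  adj : rel vertex;
  adj_sym : symmetric adj;
  adj_irr : irreflexive adj;
  vertex_gt0 : (0 < #|vertex|)%N }.

Definition graph_order (G : sgraph) : nat := #|G|.

Definition edges (G : sgraph) : {set {set G}} :=
  [set [set p.1; p.2] | p : G * G & adj p.1 p.2].

Definition graph_size (G : sgraph) : nat := #|edges G|.

Definition degree (G : sgraph) (x : G) : nat := #|[set y : G | adj x y]|.

Definition n_odd (G : sgraph) : nat := #|[set x : G | odd (degree x)]|.

(* The vertices are listed as v_1, ..., v_n by [enum_val]. *)
Definition adjacency_mx (G : sgraph) : 'M[rat]_(graph_order G) :=
  \matrix_(i, j) (adj (enum_val i) (enum_val j))%:R.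

Definition seidel_mx (G : sgraph) : 'M[rat]_(graph_order G) :=
  const_mx 1 - 1%:M - 2 *: adjacency_mx G.

(* [unitmx] over the field [rat] is invertibility; over [int] it would instead
   require determinant 1 or -1. *)
Definition singular n (M : 'M[rat]_n) : Prop := M \notin unitmx.

(* Main.v *)
(** Let [B] be the bilinear form of the Seidel matrix [S] and [x] an integral
    kernel vector with some odd entry.  Since [S = J - I] modulo 2, all entries
    of [x = 1 + 2 z] are odd and [n] is odd, so up to [x -> - x] the sum of [z]
    is even.  Then [S x = 0] modulo 4 gives [n = 1 %[mod 4]] and
    [x = 1 + 2 u + 4 y], where [u] is the indicator of the vertices of odd
    degree.  The relations [B(1, x) = B(u, x) = B(y, x) = 0] yield
    [B(1, 1) = 4 B(u, u)] modulo 16.  Here [B(1, 1) = n^2 - n - 4 m], and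
    [B(u, u) = n_odd^2 - n_odd] modulo 4 with [n_odd] even. *)
Require Import Defs.
From mathcomp Require Import all_boot all_order all_algebra.
From mathcomp Require Import zify ring.

Set Implicit Arguments.
Unset Strict Implicit.
Unset Printing Implicit Defensive.

Import Order.TTheory GRing.Theory Num.Theory.
Local Open Scope ring_scope.

(** * Double sums over vertices and the edge count *)

Lemma sum_sym_diag0 (T : finType) (V : nmodType) (F : T -> T -> V) :
  (forall i j, F i j = F j i) -> (forall i, F i i = 0) ->
  \sum_i \sum_j F i j =
  (\sum_i \sum_(j | (enum_rank i < enum_rank j)%N) F i j) *+ 2.
Proof.
move=> Fsym F0.
under eq_bigr => i _ do
  rewrite (bigID (fun j => (enum_rank i < enum_rank j)%N)) /=.
rewrite big_split mulr2n /=; congr (_ + _).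
have -> : \sum_i \sum_(j | ~~ (enum_rank i < enum_rank j)%N) F i j =
          \sum_i \sum_(j | (enum_rank j < enum_rank i)%N) F i j.
  apply: eq_bigr => i _; rewrite (bigD1 i) ?ltnn //= F0 add0r.
  apply: eq_bigl => j; rewrite -leqNgt ltn_neqAle andbC; congr (~~ _ && _).
  by rewrite -(inj_eq enum_rank_inj).
rewrite (exchange_big_dep predT) //=.
by apply: eq_bigr => i _; apply: eq_bigr => j _.
Qed.

(** [enum_rank] serves as a total order on the vertices: each edge comes from exactly one increasing
    pair. *)
Lemma graph_sizeE (G : sgraph) :
  graph_size G =
  (\sum_(i : G) \sum_(j : G | enum_rank i < enum_rank j) adj i j)%N.
Proof.
pose D := [set p : G * G | adj p.1 p.2 && (enum_rank p.1 < enum_rank p.2)%N].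
have -> : graph_size G = #|D|.
  rewrite /graph_size; have -> : edges G = [set [set p.1; p.2] | p in D].
    apply/setP=> e; apply/imsetP/imsetP=> [] [[a b]]; rewrite !inE /=.
      move=> hab ->; case: (ltngtP (enum_rank a) (enum_rank b)) => h.
      - by exists (a, b); rewrite ?inE /= ?hab.
      - by exists (b, a); rewrite ?inE /= ?(adj_sym b) ?hab 1?setUC.
      - by move: hab; rewrite (enum_rank_inj (val_inj h)) adj_irr.
    by case/andP=> hab _ ->; exists (a, b); rewrite ?inE.
  apply: card_in_imset => -[a b] [c d]; rewrite !inE /=.
  move=> /andP[_ hab] /andP[_ hcd] e; apply/eqP; rewrite xpair_eqE.
  have : a \in [set c; d] by rewrite -e set21.
  have : b \in [set c; d] by rewrite -e set22.
  rewrite !inE => /orP[] /eqP hb /orP[] /eqP ha; subst; rewrite ?eqxx //.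
  - by rewrite ltnn in hab.
  - by have := ltn_trans hab hcd; rewrite ltnn.
  - by rewrite ltnn in hab.
rewrite -sum1_card pair_big_dep /= big_mkcond [RHS]big_mkcond /=.
by apply: eq_bigr => -[a b] _; rewrite inE /=; do 2 case: ifP => //;
  case: (adj a b).
Qed.

(** * The Seidel matrix and its bilinear form over the integers *)

Definition seidel (G : sgraph) (i j : G) : int :=
  1 - (i == j)%:R - 2 * (adj i j)%:R.

Definition seidel_form (G : sgraph) (f g : G -> int) : int :=
  \sum_i f i * \sum_j seidel i j * g j.

Lemma seidel_sym (G : sgraph) (i j : G) : seidel i j = seidel j i.
Proof. by rewrite /seidel eq_sym adj_sym. Qed.

Lemma seidel_formC (G : sgraph) (f g : G -> int) :
  seidel_form f g = seidel_form g f.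
Proof.
rewrite /seidel_form; under eq_bigr => i _ do rewrite mulr_sumr.
rewrite exchange_big /=; apply: eq_bigr => j _; rewrite mulr_sumr.
by apply: eq_bigr => i _; rewrite seidel_sym mulrCA mulrA mulrC mulrA.
Qed.

Lemma seidel_actE (G : sgraph) (f : G -> int) (i : G) :
  \sum_j seidel i j * f j =
  \sum_j f j - f i - 2 * \sum_j (adj i j)%:R * f j.
Proof.
under eq_bigr => j _ do rewrite /seidel !mulrBl mul1r -mulrA.
rewrite !sumrB -mulr_sumr; congr (_ - _ - _).
rewrite (bigD1 i) //= eqxx mul1r.
rewrite big1 ?addr0 // => j /negPf; by rewrite eq_sym => ->; rewrite mul0r.
Qed.

(** The coefficient 4 is the 2 of [J - I - 2A] times the two orientations of each edge. *)
Lemma seidel_formE (G : sgraph) (f : G -> int) :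
  seidel_form f f = (\sum_i f i) ^+ 2 - \sum_i f i ^+ 2 -
   4 * \sum_(i : G) \sum_(j : G | (enum_rank i < enum_rank j)%N)
         (adj i j)%:R * f i * f j.
Proof.
rewrite /seidel_form; under eq_bigr => i _ do rewrite seidel_actE !mulrBr.
rewrite !sumrB -mulr_suml -expr2; congr (_ - _ - _).
rewrite [RHS](_ : _ = 2 * \sum_(i : G) \sum_j (adj i j)%:R * f i * f j).
  rewrite mulr_sumr; apply: eq_bigr => i _; rewrite mulrCA; congr (_ * _).
  by rewrite mulr_sumr; apply: eq_bigr => j _; rewrite mulrCA mulrA.
rewrite sum_sym_diag0; first by ring.
  by move=> i j; rewrite adj_sym mulrAC.
by move=> i; rewrite adj_irr !mul0r.
Qed.

Lemma sum_adj_lt (G : sgraph) :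
  \sum_(i : G) \sum_(j : G | (enum_rank i < enum_rank j)%N) (adj i j)%:R
  = (graph_size G)%:Z.
Proof.
rewrite graph_sizeE -natz natr_sum; apply: eq_bigr => i _.
by rewrite natr_sum.
Qed.

Lemma sum_adj (G : sgraph) (i : G) : \sum_j (adj i j)%:R = (degree i)%:Z.
Proof.
rewrite /degree -sum1_card -natz natr_sum [RHS]big_mkcond /=.
by apply: eq_bigr => j _; rewrite inE; case: (adj i j).
Qed.

Lemma handshake (G : sgraph) :
  \sum_(i : G) (degree i)%:Z = 2 * (graph_size G)%:Z.
Proof.
under eq_bigr => i _ do rewrite -sum_adj.
rewrite sum_sym_diag0 ?sum_adj_lt; first by ring.
  by move=> i j; rewrite adj_sym.
by move=> i; rewrite adj_irr.
Qed.

(** * Integral kernel vectors *)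

Lemma singular_int_kernel n (A : 'M[int]_n) :
  singular (map_mx intr A) ->
  exists x : 'I_n -> int,
    (exists i, x i != 0) /\ forall i, \sum_j A i j * x j = 0.
Proof.
(* [det0P] produces a row vector killed from the left, hence the transposition. *)
rewrite /singular unitmxE unitfE negbK -det_tr => /det0P[v v0 vA].
pose d : int := \prod_j denq (v 0 j).
have d0 : d != 0 by apply/prodf_neq0 => j _; exact: denq_neq0.
(* This is [d * v 0 j], with all denominators cleared. *)
pose x j := numq (v 0 j) * \prod_(k | k != j) denq (v 0 k).
have xE j : (x j)%:~R = d%:~R * v 0 j :> rat.
  have vE : v 0 j = (numq (v 0 j))%:~R / (denq (v 0 j))%:~R.
    by rewrite divq_num_den.
  have dE : d = denq (v 0 j) * \prod_(k | k != j) denq (v 0 k).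
    by rewrite /d (bigD1 j).
  rewrite [in RHS]vE dE !rmorphM /=.
  have : (denq (v 0 j))%:~R != 0 :> rat by rewrite intr_eq0 denq_neq0.
  by move=> ?; field.
exists x; split.
  case/rV0Pn: v0 => j hj; exists j.
  by rewrite -(intr_eq0 rat) xE mulf_neq0 // intr_eq0.
move=> i; apply/eqP; rewrite -(intr_eq0 rat) rmorph_sum /=.
under eq_bigr => j _ do rewrite intrM xE mulrCA.
rewrite -mulr_sumr; move/rowP/(_ i): vA; rewrite !mxE => vA.
rewrite (_ : \sum_j _ = 0) ?mulr0 // -[RHS]vA.
by apply: eq_bigr => j _; rewrite !mxE mulrC.
Qed.

(* Infinite descent on [`|x k|]: a kernel vector with even entries can be halved. *)
Lemma odd_kernel_vector (T : finType) (A : T -> T -> int) (x : T -> int) k :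
  x k != 0 -> (forall i, \sum_j A i j * x j = 0) ->
  exists y : T -> int,
    (exists i, (y i %% 2)%Z = 1) /\ forall i, \sum_j A i j * y j = 0.
Proof.
elim: {x}_.+1 {-2}x (ltnSn `|x k|) => // N IH x hN xk0 xA.
case: (boolP [exists i, (x i %% 2)%Z == 1]) => [/existsP[i /eqP hi]|].
  by exists x; split=> //; exists i.
rewrite negb_exists => /forallP xeven.
have xE i : x i = 2 * (x i %/ 2)%Z by move: (xeven i); lia.
have xkE := xE k; apply: (IH (fun i => (x i %/ 2)%Z)) => /=; [lia|lia|].
move=> i; have := xA i.
rewrite (eq_bigr (fun j => 2 * (A i j * (x j %/ 2)%Z))) -?mulr_sumr.
  by move/eqP; rewrite mulf_eq0 => /eqP.
by move=> j _; rewrite {1}xE mulrCA.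
Qed.

Lemma seidel_mxE (G : sgraph) :
  seidel_mx G =
  map_mx intr (\matrix_(i, j) seidel (enum_val i) (enum_val j) : 'M[int]_#|G|).
Proof.
apply/matrixP=> i j; rewrite !mxE /seidel (inj_eq enum_val_inj).
by rewrite !rmorphB rmorphM /= !rmorph_nat.
Qed.

Lemma seidel_odd_kernel (G : sgraph) : singular (seidel_mx G) ->
  exists x : G -> int, (exists i, (x i %% 2)%Z = 1) /\
    forall i, \sum_j seidel i j * x j = 0.
Proof.
rewrite seidel_mxE => /singular_int_kernel[x [[k xk0] xA]].
apply: (@odd_kernel_vector G (@seidel G) (x \o enum_rank) (enum_val k)).
  by rewrite /= enum_valK.
move=> i; rewrite -[RHS](xA (enum_rank i)).
rewrite (reindex enum_rank) /=; last first.
  by exists enum_val => ? _; rewrite ?enum_rankK ?enum_valK.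
by apply: eq_bigr => j _; rewrite !mxE !enum_rankK.
Qed.

(** * The form modulo 16 *)

Lemma seidel_form_decomp (G : sgraph) (f u x y : G -> int) :
  (forall i, x i = 1 + 2 * u i + 4 * y i) ->
  (forall i, \sum_j seidel i j * x j = 0) ->
  seidel_form f (fun=> 1) + 2 * seidel_form f u + 4 * seidel_form f y = 0.
Proof.
move=> xE xK; rewrite /seidel_form !mulr_sumr -!big_split /=.
apply: big1 => i _; rewrite !(mulrCA _ (f i)) -!mulrDr.
rewrite (_ : _ + _ = \sum_j seidel i j * x j); first by rewrite xK mulr0.
rewrite !mulr_sumr -!big_split /=.
by apply: eq_bigr => j _; rewrite xE; ring.
Qed.

(* Evaluating the identities [B(f, x) = 0] at [f = 1], [u] and [y] eliminates
   [y] modulo 16. *)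
Lemma seidel_form_mod16 (G : sgraph) (u x y : G -> int) :
  (forall i, x i = 1 + 2 * u i + 4 * y i) ->
  (forall i, \sum_j seidel i j * x j = 0) ->
  exists c, @seidel_form G (fun=> 1) (fun=> 1) = 4 * seidel_form u u + 16 * c.
Proof.
move=> xE xK.
have := seidel_form_decomp (fun=> 1) xE xK.
have := seidel_form_decomp u xE xK.
have := seidel_form_decomp y xE xK.
rewrite (seidel_formC u (fun=> 1)) (seidel_formC y (fun=> 1)).
rewrite (seidel_formC y u) => h1 h2 h3.
(* In [h3 - 2 h2 - 4 h1] the terms [B(1, u)] and [B(1, y)] cancel. *)
by exists (seidel_form u y + seidel_form y y); lia.
Qed.

Lemma sum_vertex_const (G : sgraph) (a : int) :
  \sum_(i : G) a = (graph_order G)%:Z * a.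
Proof. by rewrite sumr_const -mulr_natl natz. Qed.

Lemma seidel_form1 (G : sgraph) :
  @seidel_form G (fun=> 1) (fun=> 1) =
  (graph_order G)%:Z ^+ 2 - (graph_order G)%:Z - 4 * (graph_size G)%:Z.
Proof.
rewrite seidel_formE -sum_adj_lt; congr (_ ^+ 2 - _ - 4 * _).
- by rewrite sum_vertex_const mulr1.
- by rewrite sum_vertex_const expr1n mulr1.
- by apply: eq_bigr => i _; apply: eq_bigr => j _; rewrite !mulr1.
Qed.

Lemma sum_odd_degree (G : sgraph) :
  \sum_(i : G) (odd (degree i))%:Z = (n_odd G)%:Z.
Proof.
rewrite /n_odd -sum1_card -natz natr_sum [RHS]big_mkcond /=.
by apply: eq_bigr => i _; rewrite inE; case: odd.
Qed.

Lemma seidel_form_odd (G : sgraph) : let u (i : G) := (odd (degree i))%:Z in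
  exists c, seidel_form u u = (n_odd G)%:Z ^+ 2 - (n_odd G)%:Z - 4 * c.
Proof.
move=> u; rewrite seidel_formE sum_odd_degree.
have -> : \sum_i u i ^+ 2 = \sum_i u i.
  by apply: eq_bigr => i _; rewrite /u; case: odd.
(* The witness is the number of edges joining two vertices of odd degree. *)
by rewrite sum_odd_degree; eexists.
Qed.

(** * Kernel vectors modulo 4 and the order of the graph *)

(* Modulo 2 the Seidel matrix is [J - I], so all entries of [x] have the parity
   of their sum. *)
Lemma seidel_kernel_odd (G : sgraph) (x : G -> int) k :
  (x k %% 2)%Z = 1 -> (forall i, \sum_j seidel i j * x j = 0) ->
  exists z : G -> int, forall i, x i = 1 + 2 * z i.
Proof.
move=> xk xK; exists (fun i => ((x i - 1) %/ 2)%Z) => i.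
by have := xK i; have := xK k; rewrite !seidel_actE; lia.
Qed.

(** Row [i] of the kernel equation, expanded; [c] is the sum of [z] over the neighbours of [i]. *)
Lemma seidel_kernel_degree (G : sgraph) (z : G -> int) :
  (forall i, \sum_j seidel i j * (1 + 2 * z j) = 0) ->
  forall i, exists c, (graph_order G)%:Z - 1 - 2 * (degree i)%:Z
     + 2 * (\sum_j z j - z i) = 4 * c.
Proof.
move=> xK i; exists (\sum_j (adj i j)%:R * z j).
have := xK i; rewrite seidel_actE big_split /= sumr_const -mulr_sumr.
under [X in _ - 2 * X]eq_bigr => j _ do rewrite mulrDr mulr1 mulrCA.
rewrite big_split /= sum_adj -mulr_sumr natz -/(graph_order G) => e.
by apply: subr0_eq; rewrite -[RHS]e; ring.
Qed.

Lemma sum_multiple (T : finType) (f : T -> int) (d : int) :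
  (forall i, exists c, f i = d * c) -> exists c, \sum_i f i = d * c.
Proof.
move=> h; elim/big_ind: _ => [|a b [c ->] [e ->]|i _]; last exact: h.
  by exists 0; rewrite mulr0.
by exists (c + e); rewrite mulrDr.
Qed.

(** The degree relation at one vertex makes [n] odd. Summed over all vertices, with the handshake
    lemma and an even sum of [z], it shows that 4 divides [n (n - 1)]. *)
Lemma seidel_kernel_order (G : sgraph) (z : G -> int) c :
  (forall i, \sum_j seidel i j * (1 + 2 * z j) = 0) ->
  \sum_i z i = 2 * c -> exists k, (graph_order G)%:Z = 1 + 4 * k.
Proof.
move=> xK zc; have hdeg := seidel_kernel_degree xK.
have /card_gt0P[x0 _] := vertex_gt0 G.
have [d] := sum_multiple hdeg; rewrite big_split /= sumrB -!mulr_sumr.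
rewrite handshake !sumrB !sum_vertex_const zc => e.
have [c0 e0] := hdeg x0; rewrite zc in e0.
have [h hE] : exists h, (graph_order G)%:Z = 1 + 2 * h.
  by exists (((graph_order G)%:Z - 1) %/ 2)%Z; lia.
rewrite hE in e *; exists (h %/ 2)%Z.
have : (h %% 2)%Z = 0 by nia.
lia.
Qed.

Lemma seidel_kernel_even (G : sgraph) : singular (seidel_mx G) ->
  exists (z : G -> int) c, \sum_i z i = 2 * c /\
    forall i, \sum_j seidel i j * (1 + 2 * z j) = 0.
Proof.
case/seidel_odd_kernel=> x [[k xk] xK].
have [z xE] := seidel_kernel_odd xk xK.
have zK i : \sum_j seidel i j * (1 + 2 * z j) = 0.
  by rewrite -[RHS](xK i); apply: eq_bigr => j _; rewrite xE.
have [c0 e0] := seidel_kernel_degree zK k.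
case: (boolP ((\sum_i z i) %% 2 == 0)%Z) => hz.
  by exists z, ((\sum_i z i) %/ 2)%Z; split=> //; lia.
have sumE : \sum_i (- 1 - z i) = - (graph_order G)%:Z - \sum_i z i.
  by rewrite sumrB sum_vertex_const mulrN1.
(* Negating [1 + 2 z] replaces [z] by [- 1 - z]; as [n] is odd by [e0], this flips the parity of the
   sum. *)
exists (fun i => - 1 - z i), ((\sum_i (- 1 - z i)) %/ 2)%Z; split.
  rewrite sumE; move: e0 hz; move: (\sum_i z i) => Z; lia.
move=> i; rewrite (eq_bigr (fun j => - (seidel i j * (1 + 2 * z j)))).
  by rewrite sumrN zK oppr0.
by move=> j _; ring.
Qed.

Local Close Scope ring_scope.

(* Singularity of the Seidel matrix forces graph_order G = 1 %[mod 4], so the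
   natural-number division by 4 is exact. *)
Theorem theorem3p5 (G : sgraph) (hS : singular (seidel_mx G)) :
  graph_size G + n_odd G = (graph_order G - 1) %/ 4 %[mod 4].
Proof.
have [z [c [zc zK]]] := seidel_kernel_even hS.
have [k nE] := seidel_kernel_order zK zc.
pose u (i : G) := Posz (odd (degree i)).
pose y (i : G) := ((z i - u i) %/ 2)%Z.
have zE i : (z i = u i + 2 * y i)%R.
  (* With [n = 1 + 4 k] and an even sum of [z], the degree relation gives [z i] the parity of
     [degree i], so the division in [y] is exact. *)
  have [d] := seidel_kernel_degree zK i; rewrite zc nE /y /u; lia.
have xE i : (1 + 2 * z i = 1 + 2 * u i + 4 * y i)%R by rewrite zE; ring.
have [c1] := seidel_form_mod16 xE zK.
have [c2 ->] := seidel_form_odd G; rewrite seidel_form1 nE.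
have : (n_odd G = 2 * (c - \sum_i y i) :> int)%R.
  rewrite -sum_odd_degree mulrBr -zc mulr_sumr -sumrB.
  by apply: eq_bigr => i _; rewrite zE addrK.
(* Dividing the identity by 4 gives [k - m = n_odd^2 - n_odd] modulo 4. Since [n_odd = 2 w], the
   square vanishes and [- n_odd = n_odd] modulo 4. *)
move: (c - _)%R => w wE; rewrite wE; lia.
Qed.
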